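(* Let $(\alpha_i)_{i<\omega}$ be a sequence of ordinals and let $\beta=\bigoplus_{i<\omega}d(\alpha_i)$ (where $d(\alpha_i)$ is only considered when $\alpha_i\ne0$ in the relevant cases). Then: (a) $\bigotimes_{i<\omega}\alpha_i=0$ if and only if at least one $\alpha_i$ equals $0$. (b) If $n<\omega$ and $\alpha_i=1$ for every $i\ge n$, then $\bigotimes_{i<\omega}\alpha_i=\alpha_0\otimes\cdots\otimes\alpha_{n-1}$. (c) If $\alpha_i\ne0$ for all $i<\omega$, there is $n<\omega$ with $\alpha_i<\omega$ for all $i\ge n$, and the sequence is not eventually $1$, then $\bigotimes_{i<\omega}\alpha_i=\omega^{d(\alpha_0)\oplus\cdots\oplus d(\alpha_{n-1})+1}=\omega^{\beta+1}$. (d) If no $\alpha_i$ is $0$ and the sequence is not eventually $<\omega$ (i.e. for every $k$ there is $i\ge k$ with $\alpha_i\ge\omega$), then $\bigotimes_{i<\omega}\alpha_i=\bigotimes_{i<\omega}\omega^{d(\alpha_i)}=\omega^{\beta}$.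
   Context: For a nonzero ordinal $\alpha$ with Cantor normal form $\omega^{\xi_k}r_k+\cdots+\omega^{\xi_0}r_0$ ($\xi_k>\dots>\xi_0$, $r_i$ positive integers), the degree is $d(\alpha)=\xi_k$. $\oplus,\otimes$ are the natural (Hessenberg) sum and product, computed on Cantor normal forms as polynomials in $\omega$ with $\omega^\xi\otimes\omega^\eta=\omega^{\xi\oplus\eta}$. The infinite natural sum is $\bigoplus_{i<\omega}\beta_i=\sup_{n<\omega}(\beta_0\oplus\cdots\oplus\beta_{n-1})$. The infinite natural product is $\bigotimes_{i<\omega}\alpha_i=\lim_{i<\omega}P_i$ with $P_i=\alpha_0\otimes\cdots\otimes\alpha_{i-1}$, $P_0=1$; it equals $0$ if some $\alpha_i=0$ and $\sup_iP_i$ otherwise. Exponentiation and $+1$ are ordinal operations. *)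

(* Defs.v *)
From HB Require Import structures.
From mathcomp Require Import all_boot all_order.
From mathcomp Require Import all_classical.
From mathcomp Require Import topology.

Set Implicit Arguments.
Unset Strict Implicit.
Unset Printing Implicit Defensive.

Import Order.TTheory.

Local Open Scope classical_set_scope.
Local Open Scope order_scope.

(** A well-founded tree [Node f] stands for its rank, the least ordinal
    strictly above the ranks of all [f a].  Ordinals are trees up to equality
    of rank.  Every well-founded relation on a type of the universe of [A]
    has a rank function into [Ord] ([rank_lt] below). *)
Inductive otree : Type := Node (A : Type) (f : A -> otree).

Fixpoint tle (s t : otree) : Prop :=
  let: Node A f := s in let: Node B g := t in
  forall a : A, exists b : B, tle (f a) (g b).

Definition tlt (s t : otree) : Prop :=
  let: Node B g := t in exists b : B, tle s (g b).

Lemma tleE s t : tle s t <-> let: Node A f := s in forall a, tlt (f a) t.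
Proof. by case: s => A f; case: t => B g; split. Qed.

Lemma tle_refl t : tle t t.
Proof. by elim: t => A f IH a; exists a; apply: IH. Qed.

Lemma tle_trans s t u : tle s t -> tle t u -> tle s u.
Proof.
elim: s t u => A f IH [B g] [C h] /= st tu a.
by have [b fg] := st a; have [c gh] := tu b; exists c; apply: IH fg gh.
Qed.

Lemma tlt_le s t : tlt s t -> tle s t.
Proof.
elim: t s => B g IH s [b sg]; apply: (tle_trans sg).
have gc u : tlt u (g b) -> tlt u (Node g) by move=> /IH ub; exists b.
apply/tleE; case: (g b) gc => C h gc c; apply: gc.
by exists c; apply: tle_refl.
Qed.

Lemma tle_ltVge s t : tle s t \/ tlt t s.
Proof.
elim: s t => A f IH [B g].
case: (pselect (tle (Node f) (Node g))); first by left.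
move=> nle; right; apply: contrapT => nlt; apply: nle => a.
apply: contrapT => nex; apply: nlt; exists a; apply/tleE => b.
by have [fg|//] := IH a (g b); case: nex; exists b.
Qed.

Lemma tlt_irr t : ~ tlt t t.
Proof. by elim: t => A f IH [a /tleE /(_ a) /IH]. Qed.

Lemma tle_lt_trans s t u : tle s t -> tlt t u -> tlt s u.
Proof. by case: u => C h st [c tc]; exists c; apply: tle_trans st tc. Qed.

Lemma tltNge s t : tlt s t <-> ~ tle t s.
Proof.
split=> [st ts|nts]; first by apply: (@tlt_irr t); apply: tle_lt_trans ts st.
by have [] := tle_ltVge t s.
Qed.

HB.instance Definition _ := gen_eqMixin otree.
HB.instance Definition _ := gen_choiceMixin otree.

Definition teq (s t : otree) : bool := `[< tle s t /\ tle t s >].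

Lemma teq_refl : reflexive teq.
Proof. by move=> t; apply/asboolP; split; apply: tle_refl. Qed.

Lemma teq_sym : symmetric teq.
Proof. by move=> s t; apply/asboolP/asboolP => -[]. Qed.

Lemma teq_trans : transitive teq.
Proof.
move=> t s u /asboolP[st ts] /asboolP[tu ut]; apply/asboolP.
by split; [apply: tle_trans st tu | apply: tle_trans ut ts].
Qed.

Canonical teq_equiv := EquivRel teq teq_refl teq_sym teq_trans.

Local Open Scope quotient_scope.

Definition Ord : Type := {eq_quot teq}.
HB.instance Definition _ := Choice.on Ord.

Definition orank (t : otree) : Ord := \pi_{eq_quot teq} t.
Definition otree_of (x : Ord) : otree := repr (x : {eq_quot teq}).

Lemma otree_ofK x : orank (otree_of x) = x.
Proof. exact: reprK. Qed.

Lemma orankK t : tle (otree_of (orank t)) t /\ tle t (otree_of (orank t)).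
Proof.
apply/asboolP; rewrite -/(teq _ _) /otree_of /orank.
by apply/eqmodP; rewrite reprK.
Qed.

Definition ole (x y : Ord) : bool := `[< tle (otree_of x) (otree_of y) >].

Lemma ole_refl : reflexive ole.
Proof. by move=> x; apply/asboolP; apply: tle_refl. Qed.

Lemma ole_anti : antisymmetric ole.
Proof.
move=> x y /andP[/asboolP xy /asboolP yx].
by rewrite -[x]otree_ofK -[y]otree_ofK; apply/eqmodP/asboolP.
Qed.

Lemma ole_trans : transitive ole.
Proof.
by move=> y x z /asboolP xy /asboolP yz; apply/asboolP; apply: tle_trans xy yz.
Qed.

Fact ord_display : Order.disp_t. Proof. exact: Order.Disp tt tt. Qed.

HB.instance Definition _ :=
  Order.Le_isPOrder.Build ord_display Ord ole_refl ole_anti ole_trans.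

Lemma ole_total : total (<=%O : rel Ord).
Proof.
move=> x y; have [xy|/tlt_le yx] := tle_ltVge (otree_of x) (otree_of y).
  by apply/orP; left; apply/asboolP.
by apply/orP; right; apply/asboolP.
Qed.

HB.instance Definition _ := Order.POrder_isTotal.Build ord_display Ord ole_total.

Lemma oleP (x y : Ord) : x <= y <-> tle (otree_of x) (otree_of y).
Proof. by split=> /asboolP. Qed.

Lemma oltP (x y : Ord) : x < y <-> tlt (otree_of x) (otree_of y).
Proof.
by rewrite ltNge tltNge -oleP; split=> [/negP|/negP].
Qed.

Lemma olt_wf : well_founded (fun x y : Ord => x < y).
Proof.
move=> x; suff: forall t y, tle (otree_of y) t -> Acc (fun x y : Ord => x < y) y.
  by apply; apply: tle_refl.
elim=> A f IH y yt; constructor=> z /oltP zy.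
have: tlt (otree_of z) (Node f).
  apply/tltNge => tz; move/tltNge: zy; apply; apply: tle_trans yt tz.
by move=> [a /IH].
Qed.

(** Least strict upper bound of a family indexed by a type of the universe. *)
Definition olsub (A : Type) (F : A -> Ord) : Ord :=
  orank (Node (fun a => otree_of (F a))).

Lemma olt_lsub (A : Type) (F : A -> Ord) x :
  x < olsub F <-> exists a, x <= F a.
Proof.
have [le1 le2] := orankK (Node (fun a => otree_of (F a))).
split=> [/oltP xF|[a /oleP xa]].
  have: tlt (otree_of x) (Node (fun a => otree_of (F a))).
    by apply/tltNge => /(tle_trans le1); apply/tltNge.
  by move=> [a /oleP xa]; exists a.
apply/oltP/tltNge => /(tle_trans le2); apply/tltNge.
by exists a.
Qed.

Definition ozero : Ord := olsub (fun i : void => match i with end).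
Definition osucc (x : Ord) : Ord := olsub (fun _ : unit => x).
Definition onat (n : nat) : Ord := iter n osucc ozero.
Definition omega : Ord := olsub onat.

HB.instance Definition _ := isPointed.Build Ord ozero.
HB.instance Definition _ := OrderTopological.copy Ord (order_topology Ord).

Lemma ole0x x : ozero <= x.
Proof. by rewrite leNgt; apply/negP => /olt_lsub[[]]. Qed.

Lemma olt_succ x y : (x < osucc y) = (x <= y).
Proof. by apply/idP/idP => [/olt_lsub[]|xy] //; apply/olt_lsub; exists tt. Qed.

Lemma olt_omega x : x < omega <-> exists n, x = onat n.
Proof.
split=> [/olt_lsub[n]|[n ->]]; last by apply/olt_lsub; exists n.
elim: n => [|n IH] xn; first by exists 0%N; apply/le_anti; rewrite xn ole0x.
have [xn'|nx] := leP x (onat n); first exact: IH.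
exists n.+1; apply/le_anti; rewrite xn /= leNgt olt_succ -ltNge.
exact: nx.
Qed.

(** The order type of any well-founded relation on a type of the universe. *)
Lemma rank_lt (A : Type) (r : A -> A -> Prop) : well_founded r ->
  exists F : A -> Ord, forall a,
    (forall b, r b a -> F b < F a) /\
    (forall x, x < F a -> exists2 b, r b a & x <= F b).
Proof.
move=> wf; pose G a (rec : forall b, r b a -> Ord) :=
  olsub (fun p : {b | r b a} => rec (sval p) (svalP p)).
pose F := Fix wf (fun _ => Ord) G; exists F => a.
have -> : F a = G a (fun b _ => F b).
  apply: (@Fix_eq A r wf (fun _ => Ord) G) => x f g fg.
  by congr olsub; apply/funext => -[b rb]; exact: fg.
split=> [b rb|x /olt_lsub[[b rb]] xb]; last by exists b.
by apply/olt_lsub; exists (exist _ b rb).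
Qed.

(** Initial segments are indexed by types of the universe, so a function on an
    initial segment is bounded. *)
Fixpoint tnode (t : otree) : Type :=
  let: Node A f := t in {a : A & option (tnode (f a))}.

Fixpoint tsub (t : otree) : tnode t -> otree :=
  match t with
  | Node A f => fun n : {a : A & option (tnode (f a))} =>
    let: existT a o := n in if o is Some m then tsub m else f a
  end.

Lemma oseg_small (x : Ord) :
  exists (A : Type) (F : A -> Ord), forall y, y < x -> exists a, y = F a.
Proof.
exists (tnode (otree_of x)), (fun n => orank (tsub n)) => y /oltP.
elim: (otree_of x) => A f IH [a ya].
have [ay|ya'] := tle_ltVge (f a) (otree_of y); last first.
  by have [n ->] := IH a ya'; exists (existT _ a (Some n)).
exists (existT _ a None) => /=; rewrite -[y]otree_ofK.
by apply/eqmodP/asboolP.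
Qed.

Definition osup (S : set Ord) : Ord := supremum ozero S.

Lemma osup_le (S : set Ord) y : has_ubound S ->
  osup S <= y <-> forall x, S x -> x <= y.
Proof.
move=> [u0 ubu0]; rewrite /osup /supremum; case: eqVneq => [->|S0].
  by split=> // _; apply: ole0x.
have : exists s, supremums S s.
  suff: exists2 s, ubound S s & forall t, ubound S t -> s <= t.
    by move=> [s us ls]; exists s; split.
  elim: {u0}(olt_wf u0) ubu0 => u _ IH ubu.
  case: (pselect (forall t, ubound S t -> u <= t)) => [lu|]; first by exists u.
  move=> /existsNP[t /not_implyP[ut /negP]]; rewrite -ltNge => tu.
  exact: IH tu ut.
move=> [s Ss]; case: xgetP => [z _ [uz lz]|/(_ s)//].
split=> [zy x Sx|uy]; last exact: lz.
by apply: le_trans zy; apply: uz.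
Qed.

Lemma oseg_bounded (x : Ord) (F : Ord -> Ord) : has_ubound (F @` [set y | y < x]).
Proof.
have [A [G xG]] := oseg_small x.
exists (olsub (fun a => F (G a))) => _ [y yx <-]; have [a ->] := xG y yx.
by apply/ltW/olt_lsub; exists a.
Qed.

(** [orec a h] is the function [G] with [G b = sup ({a} U {h (G c) | c < b})]. *)
Definition orec (a : Ord) (h : Ord -> Ord) : Ord -> Ord :=
  Fix olt_wf (fun _ => Ord) (fun b rec =>
    osup ([set a] `|` [set x | exists c (cb : c < b), x = h (rec c cb)])).

Lemma orecE a h b :
  orec a h b = osup ([set a] `|` [set h (orec a h c) | c in [set c | c < b]]).
Proof.
rewrite /orec Fix_eq => [|x f g fg]; congr (osup (_ `|` _)); apply/seteqP.
  split=> y /= [c]; first by move=> [cb ->]; exists c.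
  by move=> cb <-; exists c, cb.
by split=> y /= [c [cx ->]]; exists c, cx; rewrite fg.
Qed.

Lemma orec_ub a h b :
  has_ubound ([set a] `|` [set h (orec a h c) | c in [set c | c < b]]).
Proof.
have [u uP] := oseg_bounded b (fun c => h (orec a h c)).
exists (Order.max a u) => x [->|[c cb <-]]; first by rewrite le_max lexx.
by rewrite le_max (uP (h (orec a h c))) ?orbT //; exists c.
Qed.

Lemma orec_le a h b y :
  orec a h b <= y <-> a <= y /\ (forall c, c < b -> h (orec a h c) <= y).
Proof.
rewrite orecE osup_le; last exact: orec_ub.
split=> [H|[ay H] x [->|[c cb <-]]//]; last exact: H.
by split=> [|c cb]; apply: H; [left|right; exists c].
Qed.

Lemma orec_mono a h b c : b <= c -> orec a h b <= orec a h c.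
Proof.
move=> bc; have [ay H] := (orec_le a h c _).1 (lexx _).
by apply/orec_le; split=> // d db; apply: H; apply: lt_le_trans db bc.
Qed.

Lemma orec0 a h : orec a h ozero = a.
Proof.
apply/le_anti/andP; split; last by have [] := (orec_le a h ozero _).1 (lexx _).
by apply/orec_le; split=> // c; rewrite ltNge ole0x.
Qed.

Lemma orecS a h b :
  (forall x, x <= h x) -> {homo h : x y / x <= y} ->
  orec a h (osucc b) = h (orec a h b).
Proof.
move=> hinf hm.
apply/le_anti/andP; split.
  apply/orec_le; split=> [|c].
    by apply: le_trans (hinf _); rewrite -{1}(orec0 a h) orec_mono ?ole0x.
  by rewrite olt_succ => cb; apply/hm/orec_mono.
have [_] := (orec_le a h (osucc b) _).1 (lexx _); apply.
by rewrite olt_succ.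
Qed.

Lemma orec_lim a h b :
  (forall x, x <= h x) -> b <> ozero -> (forall c, c < b -> osucc c < b) ->
  {homo h : x y / x <= y} ->
  orec a h b = osup (orec a h @` [set c | c < b]).
Proof.
move=> hinf b0 bl hm; have ub := oseg_bounded b (orec a h).
have b0' : ozero < b by rewrite lt_neqAle ole0x andbT; apply/eqP => /esym.
apply/le_anti/andP; split.
  have H := (osup_le _ ub).1 (lexx _).
  apply/orec_le; split=> [|c cb].
    by apply: H; exists ozero => //; rewrite orec0.
  by rewrite -orecS //; apply: H; exists (osucc c) => //; apply: bl.
by apply/(osup_le _ ub) => _ [c cb <-]; apply/orec_mono/ltW.
Qed.

(** The recursions below use one clause for all [b]; [oadd0], [oaddS], [oadd_lim]
    and the analogous lemmas give the usual zero, successor and limit clauses. *)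
Definition oadd (a : Ord) : Ord -> Ord := orec a osucc.
Definition omul (a : Ord) : Ord -> Ord := orec ozero (fun x => oadd x a).
Definition oexp_omega : Ord -> Ord := orec (onat 1) (fun x => omul x omega).

Lemma ole_succ x : x <= osucc x.
Proof. by apply/ltW; rewrite olt_succ. Qed.

Lemma osucc_mono : {homo osucc : x y / x <= y}.
Proof. by move=> x y xy; rewrite leNgt olt_succ -ltNge; rewrite olt_succ. Qed.

Definition olimit (b : Ord) : Prop :=
  b <> ozero /\ (forall c, c < b -> osucc c < b).

Lemma oadd0 a : oadd a ozero = a.
Proof. exact: orec0. Qed.

Lemma oaddS a b : oadd a (osucc b) = osucc (oadd a b).
Proof. apply: orecS; [exact: ole_succ|exact: osucc_mono]. Qed.

Lemma oadd_lim a b : olimit b -> oadd a b = osup (oadd a @` [set c | c < b]).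
Proof. move=> [? ?]; apply: orec_lim => //; [exact: ole_succ|exact: osucc_mono]. Qed.

Lemma ole_addr a x : x <= oadd x a.
Proof. by rewrite -{1}(oadd0 x) orec_mono ?ole0x. Qed.

Lemma oadd_monol a : {homo (fun x => oadd x a) : x y / x <= y}.
Proof.
move=> x y xy; elim: {a}(olt_wf a) => a _ IH.
apply/orec_le; split; first by apply: le_trans xy (ole_addr _ _).
move=> c ca; apply: (le_trans (@osucc_mono _ _ (IH c ca))).
by have [_] := (orec_le y osucc a _).1 (lexx _); apply.
Qed.

Lemma omul0 a : omul a ozero = ozero.
Proof. exact: orec0. Qed.

Lemma omulS a b : omul a (osucc b) = oadd (omul a b) a.
Proof.
by apply: (@orecS _ (fun x => oadd x a)); [exact: ole_addr|exact: oadd_monol].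
Qed.

Lemma omul_lim a b :
  olimit b -> omul a b = osup (omul a @` [set c | c < b]).
Proof.
by move=> [? ?]; apply: (@orec_lim _ (fun x => oadd x a)) => //;
  [exact: ole_addr|exact: oadd_monol].
Qed.

Lemma omul_monol a : {homo (fun x => omul x a) : x y / x <= y}.
Proof.
move=> x y xy; elim: {a}(olt_wf a) => a _ IH.
apply/orec_le; split; first exact: ole0x.
move=> c ca; apply: (@le_trans _ _ (oadd (omul y c) y)).
  by apply: (le_trans (@oadd_monol _ _ _ (IH c ca))); apply: orec_mono.
by have [_] := (orec_le ozero (fun x => oadd x y) a _).1 (lexx _); apply.
Qed.

Lemma oadd0l x : oadd ozero x = x.
Proof.
elim: {x}(olt_wf x) => x _ IH; apply/le_anti/andP; split.
  apply/orec_le; split=> [|c cx]; first exact: ole0x.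
  by rewrite -/(oadd _ c) IH // leNgt olt_succ -ltNge.
rewrite leNgt; apply/negP => lt.
have [_ /(_ _ lt)] := (orec_le ozero osucc x _).1 (lexx _).
by rewrite -/(oadd _ _) IH // leNgt olt_succ lexx.
Qed.

Lemma olimit_omega : olimit omega.
Proof.
split=> [e|c /olt_omega[n ->]]; last by apply/olt_omega; exists n.+1.
have : ozero < omega by apply/olt_omega; exists 0%N.
by rewrite e ltxx.
Qed.

Lemma omul1 x : omul x (onat 1) = x.
Proof. by rewrite omulS omul0 oadd0l. Qed.

Lemma omul_inf x : x <= omul x omega.
Proof. by rewrite -{1}(omul1 x); apply/orec_mono/ltW/olt_omega; exists 1%N. Qed.

Lemma oexp0 : oexp_omega ozero = onat 1.
Proof. exact: orec0. Qed.

Lemma oexpS b : oexp_omega (osucc b) = omul (oexp_omega b) omega.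
Proof.
by apply: (@orecS _ (fun x => omul x omega));
  [exact: omul_inf|exact: omul_monol].
Qed.

Lemma oexp_lim b :
  olimit b -> oexp_omega b = osup (oexp_omega @` [set c | c < b]).
Proof.
by move=> [? ?]; apply: (@orec_lim _ (fun x => omul x omega)) => //;
  [exact: omul_inf|exact: omul_monol].
Qed.

(** [[:: (xi_k, r_k); ...; (xi_0, r_0)]] with [xi_k > ... > xi_0] and [r_i > 0]
    stands for [omega^xi_k r_k + ... + omega^xi_0 r_0].  By Cantor's theorem
    [cnf a] is the unique such list with value [a]; it is empty for [ozero]. *)
Definition cnf_form (s : seq (Ord * nat)) : bool :=
  sorted >%O (unzip1 s) && all (fun t => (0 < t.2)%N) s.

Definition cnf_val (s : seq (Ord * nat)) : Ord :=
  \big[oadd/ozero]_(t <- s) omul (oexp_omega t.1) (onat t.2).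

Definition cnf (a : Ord) : seq (Ord * nat) :=
  xget [::] [set s | cnf_form s /\ cnf_val s = a].

(** Meaningful for [a <> ozero] only; [deg ozero] is a dummy value. *)
Definition deg (a : Ord) : Ord := head ozero (unzip1 (cnf a)).

(** A list of monomials, in any order and with possible repetitions, seen as a
    polynomial in [omega]: coefficient of [omega^x], and collected form. *)
Definition ocoef (s : seq (Ord * nat)) (x : Ord) : nat :=
  (\sum_(t <- s | t.1 == x) t.2)%N.

Definition ocollect (s : seq (Ord * nat)) : seq (Ord * nat) :=
  [seq (x, ocoef s x) | x <- sort >=%O (undup (unzip1 s))].

(** Natural sum and product are the sum and product of polynomials in [omega],
    where [omega^x] times [omega^y] is [omega^(nsum x y)]. *)
Definition nsum (a b : Ord) : Ord := cnf_val (ocollect (cnf a ++ cnf b)).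

Definition nprod (a b : Ord) : Ord :=
  cnf_val (ocollect [seq (nsum t.1 u.1, (t.2 * u.2)%N) | t <- cnf a, u <- cnf b]).

Definition nsum_lt (b : nat -> Ord) (n : nat) : Ord :=
  \big[nsum/ozero]_(i < n) b i.

Definition nprod_lt (a : nat -> Ord) (n : nat) : Ord :=
  \big[nprod/onat 1]_(i < n) a i.

Definition nsum_inf (b : nat -> Ord) : Ord := osup (range (nsum_lt b)).

(** The limit is taken in the order topology. *)
Definition nprod_inf (a : nat -> Ord) : Ord := lim (nprod_lt a @ \oo).

(* Main.v *)
(** Each partial product [P_n] is nonzero when all factors are, and comparing
    leading monomials gives [omega^d k <= P_n < omega^d (k+1)], where [d] is the
    natural sum of the degrees and [k] the product of the leading coefficients
    of the factors.  If the factors are eventually finite and not eventually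
    [1], then [d] stabilizes while [k] is unbounded, so [P_n] converges to
    [omega^(d+1)].  If infinitely many factors are infinite, the sequence of the
    [d]'s is strictly increasing infinitely often, and
    [omega^d <= P_n < omega^(d+1)] squeezes [P_n] to [omega^beta].
    Associativity of the natural operations is not needed, since the partial
    sums and products are right folds and only leading monomials matter. *)

Require Import Defs.
From mathcomp Require Import all_boot all_order.
From mathcomp Require Import all_classical.
From mathcomp Require Import interval topology.

Set Implicit Arguments.
Unset Strict Implicit.
Unset Printing Implicit Defensive.

Import Order.TTheory.

Local Open Scope classical_set_scope.
Local Open Scope order_scope.

Implicit Types (a b c r x y z : Ord) (s t : seq (Ord * nat)) (k m n : nat).

(** * Order and monotonicity of ordinal sums, products and powers of omega *)

Lemma olt_gt0 x y : x < y -> ozero < y.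
Proof. exact/le_lt_trans/ole0x. Qed.

Lemma one_gt0 : ozero < onat 1.
Proof. by rewrite olt_succ. Qed.

Lemma osucc_le x y : (osucc x <= y) = (x < y).
Proof. by rewrite leNgt olt_succ -ltNge. Qed.

Lemma one_le x : (onat 1 <= x) = (x != ozero).
Proof. by rewrite /= osucc_le lt_neqAle ole0x andbT eq_sym. Qed.

Lemma ogt0 x : (ozero < x) = (x != ozero).
Proof. by rewrite -one_le osucc_le. Qed.

(** This and the next two lemmas read the recursion as a least upper bound property, so that
    estimates can be made without splitting into zero, successor and limit cases. *)
Lemma oadd_le a b y :
  oadd a b <= y <-> a <= y /\ (forall c, c < b -> oadd a c < y).
Proof.
split=> [/orec_le[ay H]|[ay H]].
  by split=> // c /H; rewrite osucc_le.
by apply/orec_le; split=> // c /H; rewrite -osucc_le.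
Qed.

Lemma omul_le a b y :
  omul a b <= y <-> (forall c, c < b -> oadd (omul a c) a <= y).
Proof.
split=> [/orec_le[]//|H].
by apply/orec_le; split=> //; exact: ole0x.
Qed.

Lemma oexp_le b y : oexp_omega b <= y <->
  onat 1 <= y /\ (forall c, c < b -> omul (oexp_omega c) omega <= y).
Proof. exact: orec_le. Qed.

Lemma oadd_ltr a b c : b < c -> oadd a b < oadd a c.
Proof. by move=> bc; have [_] := (oadd_le a c _).1 (lexx _); apply. Qed.

Lemma omul_ler a b c : b <= c -> omul a b <= omul a c.
Proof. exact: orec_mono. Qed.

Lemma omul_ltr a b c : ozero < a -> b < c -> omul a b < omul a c.
Proof.
move=> a0 bc; have /(_ _ bc) := (omul_le a c _).1 (lexx _); apply: lt_le_trans.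
by rewrite -{1}(oadd0 (omul a b)) oadd_ltr.
Qed.

Lemma oexp_ler b c : b <= c -> oexp_omega b <= oexp_omega c.
Proof. exact: orec_mono. Qed.

Lemma oexp_gt0 b : ozero < oexp_omega b.
Proof. by have [+ _] := (oexp_le b _).1 (lexx _); rewrite one_le ogt0. Qed.

Lemma onat_lt_omega n : onat n < omega.
Proof. by apply/olt_omega; exists n. Qed.

Lemma oexp_ltr b c : b < c -> oexp_omega b < oexp_omega c.
Proof.
move=> bc; have [_ /(_ _ bc)] := (oexp_le c _).1 (lexx _).
apply: lt_le_trans; rewrite -{1}(omul1 (oexp_omega b)) omul_ltr ?oexp_gt0 //.
exact: onat_lt_omega.
Qed.

Lemma oexp_lt_ler b c : (oexp_omega b < oexp_omega c) = (b < c).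
Proof.
apply/idP/idP=> [|/oexp_ltr//]; apply: contraTT.
rewrite -!leNgt; exact: oexp_ler.
Qed.

Lemma ole_oexp b : b <= oexp_omega b.
Proof.
elim: {b}(olt_wf b) => b _ IH; rewrite leNgt; apply/negP => lt.
by have := IH _ lt; rewrite leNgt oexp_ltr.
Qed.

Lemma onat_ltr m n : (m < n)%N -> onat m < onat n.
Proof.
elim: n => // n IH; rewrite ltnS leq_eqVlt => /predU1P[->|/IH mn].
  by rewrite /= olt_succ.
by apply: lt_trans mn _; rewrite /= olt_succ.
Qed.

Lemma onat_ler m n : (m <= n)%N -> onat m <= onat n.
Proof. by rewrite leq_eqVlt => /predU1P[->//|/onat_ltr/ltW]. Qed.

Lemma omul1l n : omul (onat 1) (onat n) = onat n.
Proof. by elim: n => [|n IH]; rewrite ?omul0 // omulS IH oaddS oadd0. Qed.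

Lemma oexp_mul_lt x y n : x < y -> omul (oexp_omega x) (onat n) < oexp_omega y.
Proof.
move=> xy; have [_ /(_ _ xy)] := (oexp_le y _).1 (lexx _).
by apply: lt_le_trans; rewrite omul_ltr ?oexp_gt0 ?onat_lt_omega.
Qed.

(** By [omul_le], [omul b omega] is the least upper bound of the products [omul b (onat n.+1)], so
    nothing smaller bounds them all. *)
Lemma lt_omul_omega y b : y < omul b omega ->
  exists n, y < omul b (onat n.+1).
Proof.
move=> yb; apply: contrapT => /forallNP H; move: yb; apply/negP.
rewrite -leNgt; apply/omul_le => _ /olt_omega[n ->].
by rewrite -omulS leNgt; apply/negP/H.
Qed.

(** A power of omega is the least upper bound of [onat 1] and of the powers with exponent [osucc c],
    [c < b]. The alternative [y = ozero] accounts for the term [onat 1]. *)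
Lemma lt_oexp y b : y < oexp_omega b -> y = ozero \/
  exists2 c, c < b & y < oexp_omega (osucc c).
Proof.
move=> yb; case: (eqVneq y ozero); [by left|rewrite -one_le => y1; right].
apply: contrapT => H; move: yb; apply/negP; rewrite -leNgt.
apply/oexp_le; split=> // c cb; rewrite -oexpS leNgt.
by apply/negP => yc; apply: H; exists c.
Qed.

Lemma omin_exists (P : Ord -> Prop) x : P x ->
  exists y, P y /\ forall z, z < y -> ~ P z.
Proof.
elim: {x}(olt_wf x) => x _ IH Px.
case: (pselect (exists2 z, z < x & P z)) => [[z /IH]//|H].
by exists x; split=> // z zx Pz; apply: H; exists z.
Qed.

(** The remainder is the least [r] with [a <= oadd b r]: by minimality [oadd b c < a] for all
    [c < r], which gives the other inequality. *)
Lemma osub_exists a b : b <= a -> exists r, a = oadd b r.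
Proof.
(* Some such [r] exists, namely [a]: a strictly increasing map never falls below its argument. *)
move=> ba; have : a <= oadd b a.
  elim: {a ba}(olt_wf a) => a _ IH; rewrite leNgt; apply/negP => lt.
  have := IH _ lt; apply/negP; rewrite -ltNge; exact: oadd_ltr.
move=> /(omin_exists (P := fun r => a <= oadd b r))[r [ar H]]; exists r.
apply/le_anti; rewrite ar; apply/oadd_le; split=> // c /H /negP.
by rewrite -ltNge.
Qed.

(** * Cantor normal forms *)

(** The least exponent whose power exceeds [a] lies above some [x] with
    [omega^x <= a < omega^(x+1)]. Then the largest multiple of [omega^x] below or equal to [a] is
    split off. *)
Lemma cnf_step a : a != ozero -> exists x n r,
  [/\ a = oadd (omul (oexp_omega x) (onat n.+1)) r & r < oexp_omega x].
Proof.
move=> a0; have : a < oexp_omega (osucc a).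
  by apply: lt_le_trans (ole_oexp _); rewrite olt_succ.
move=> /(omin_exists (P := fun x => a < oexp_omega x))[y [ay ymin]].
have [az|[x xy axS]] := lt_oexp ay; first by rewrite az eqxx in a0.
have xa : oexp_omega x <= a by rewrite leNgt; apply/negP/ymin.
move: axS; rewrite oexpS => /lt_omul_omega[n].
(* Descend from a multiple exceeding [a] until the preceding one no longer does; the descent stops
   because [omega^x <= a]. *)
elim: n => [|n IH] an; first by move: an; rewrite omul1 ltNge xa.
have [/IH//|na] := ltP a (omul (oexp_omega x) (onat n.+1)).
have [r ar] := osub_exists na; exists x, n, r; split=> //.
rewrite ltNge; apply/negP => xr; move: an; apply/negP; rewrite -leNgt ar.
by rewrite (omulS _ (onat n.+1)) /oadd; apply: orec_mono.
Qed.

Lemma cnf_val_nil : cnf_val [::] = ozero.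
Proof. exact: big_nil. Qed.

Lemma cnf_val_cons x n s :
  cnf_val ((x, n) :: s) = oadd (omul (oexp_omega x) (onat n)) (cnf_val s).
Proof. exact: big_cons. Qed.

Lemma gt_trans : transitive (>%O : rel Ord).
Proof. by move=> y x z /= yx zy; apply: lt_trans zy yx. Qed.

Lemma cnf_form_cons x n s : cnf_form ((x, n) :: s) =
  [&& (0 < n)%N, all (fun p => p.1 < x) s & cnf_form s].
Proof.
rewrite /cnf_form /= (path_sortedE gt_trans) all_map /=.
by rewrite -!andbA; do !bool_congr.
Qed.

(** If [omega^y n] is the first monomial, the tail is below [omega^y] by induction, so the value is
    below [omega^y (n+1)], hence below [omega^x]. *)
Lemma cnf_val_lt s x : cnf_form s -> all (fun p => p.1 < x) s ->
  cnf_val s < oexp_omega x.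
Proof.
elim: s x => [|[y n] s IH] x; first by rewrite cnf_val_nil oexp_gt0.
rewrite cnf_form_cons cnf_val_cons => /and3P[n0 sy fs] /= /andP[yx _].
apply: lt_trans (oexp_mul_lt n.+1 yx).
by rewrite omulS oadd_ltr // IH.
Qed.

Lemma cnf_val_bounds x n s : cnf_form ((x, n) :: s) ->
  omul (oexp_omega x) (onat n) <= cnf_val ((x, n) :: s) <
  omul (oexp_omega x) (onat n.+1).
Proof.
rewrite cnf_form_cons cnf_val_cons => /and3P[n0 sy fs].
by rewrite ole_addr omulS oadd_ltr // cnf_val_lt.
Qed.

Lemma cnf_val_ge x n s : cnf_form ((x, n) :: s) ->
  oexp_omega x <= cnf_val ((x, n) :: s).
Proof.
move=> fs; have /andP[+ _] := cnf_val_bounds fs; apply: le_trans.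
rewrite -{1}(omul1 (oexp_omega x)) omul_ler // onat_ler //.
by move: fs; rewrite cnf_form_cons => /and3P[].
Qed.

Lemma cnf_exists a : exists s, cnf_form s /\ cnf_val s = a.
Proof.
elim: {a}(olt_wf a) => a _ IH; case: (eqVneq a ozero) => [->|].
  by exists [::]; rewrite cnf_val_nil.
move=> /cnf_step[x [n [r [ar rx]]]].
have xa : oexp_omega x <= a.
  rewrite ar; apply: le_trans (ole_addr _ _).
  by rewrite -{1}(omul1 (oexp_omega x)) omul_ler ?onat_ler.
have [s [fs sr]] := IH r (lt_le_trans rx xa).
exists ((x, n.+1) :: s); rewrite cnf_val_cons sr -ar cnf_form_cons fs andbT /=.
split=> //; case: s fs sr => //= -[y m] s fs sr.
(* The remainder lies between [omega^y] and [omega^x], so its leading exponent is smaller than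
   [x]. *)
have yx : y < x by rewrite -oexp_lt_ler (le_lt_trans (cnf_val_ge fs)) ?sr.
move: fs; rewrite cnf_form_cons => /and3P[_ /allP sy _] /=.
by rewrite yx; apply/allP => p /sy py; apply: lt_trans yx.
Qed.

Lemma cnf_spec a : cnf_form (cnf a) /\ cnf_val (cnf a) = a.
Proof.
by rewrite /cnf; case: xgetP => [s _ //|H]; have [s /H] := cnf_exists a.
Qed.

Lemma cnf_formP a : cnf_form (cnf a). Proof. by case: (cnf_spec a). Qed.
Lemma cnfK a : cnf_val (cnf a) = a. Proof. by case: (cnf_spec a). Qed.

(** * Coefficients and lexicographic comparison; uniqueness of the normal form *)

Lemma ocoef_nil x : ocoef [::] x = 0%N.
Proof. exact: big_nil. Qed.

Lemma ocoef_cons p s x : ocoef (p :: s) x = ((p.1 == x) * p.2 + ocoef s x)%N.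
Proof. by rewrite /ocoef big_cons; case: eqP => _; rewrite ?mul1n. Qed.

Lemma ocoef_cat s t x : ocoef (s ++ t) x = (ocoef s x + ocoef t x)%N.
Proof. exact: big_cat. Qed.

Lemma ocoef_out s x : x \notin unzip1 s -> ocoef s x = 0%N.
Proof.
elim: s => [|p s IH]; rewrite ?ocoef_nil //= inE negb_or ocoef_cons eq_sym.
by case/andP=> /negPf -> /IH ->.
Qed.

Lemma ocoef_out_lt s x : all (fun p => p.1 < x) s -> ocoef s x = 0%N.
Proof.
move=> /allP sx; apply: ocoef_out; apply/mapP => -[p /sx px xp].
by rewrite xp ltxx in px.
Qed.

Lemma all_lt_trans s x y : x <= y -> all (fun p => p.1 < x) s ->
  all (fun p => p.1 < y) s.
Proof. by move=> xy; apply: sub_all => p px; apply: lt_le_trans xy. Qed.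

(** Comparison at the highest exponent where the coefficients differ. Phrasing it through
    coefficients makes it insensitive to the order and grouping of monomials, so it suits sums of
    polynomials. *)
Definition lexlt s t : Prop := exists x,
  (ocoef s x < ocoef t x)%N /\ forall y, x < y -> ocoef s y = ocoef t y.

Lemma lexlt_val s t : cnf_form s -> cnf_form t -> lexlt s t ->
  cnf_val s < cnf_val t.
Proof.
elim: s t => [|[y m] s IH] [|[z n] t].
- by move=> _ _ [x []]; rewrite ltnn.
- move=> _ ft _; apply: lt_le_trans (cnf_val_ge ft).
  by rewrite cnf_val_nil oexp_gt0.
- by move=> _ _ [x []]; rewrite ocoef_nil ltn0.
move=> fs ft [x [lt eqc]].
move: (fs) (ft); rewrite !cnf_form_cons => /and3P[m0 sy fs'] /and3P[n0 tz ft'].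
have cy : ocoef ((y, m) :: s) y = m.
  by rewrite ocoef_cons eqxx mul1n (ocoef_out_lt sy) addn0.
have cz : ocoef ((z, n) :: t) z = n.
  by rewrite ocoef_cons eqxx mul1n (ocoef_out_lt tz) addn0.
have outt w : z < w -> ocoef ((z, n) :: t) w = 0%N.
  by move=> zw; rewrite ocoef_out_lt //= zw (all_lt_trans (ltW zw)).
have outs w : y < w -> ocoef ((y, m) :: s) w = 0%N.
  by move=> zw; rewrite ocoef_out_lt //= zw (all_lt_trans (ltW zw)).
(* The coefficient of the second form at [x] is positive, so [x] cannot exceed its leading
   exponent. *)
have xz : x <= z by rewrite leNgt; apply/negP => /outt E; rewrite E in lt.
case: (ltgtP y z) => [yz|zy|yz].
- apply: lt_le_trans (cnf_val_ge ft); apply: cnf_val_lt => //=.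
  by rewrite yz (all_lt_trans (ltW yz)).
(* Here [y] lies above [x], where the coefficients agree; but they are [m > 0] and zero. *)
- have := eqc y (le_lt_trans xz zy); rewrite cy outt // => E.
  by rewrite E in m0.
subst z; case: (ltngtP m n) => [mn|nm|mn].
- have /andP[_ /lt_le_trans] := cnf_val_bounds fs; apply.
  have /andP[+ _] := cnf_val_bounds ft; apply: le_trans.
  by rewrite omul_ler ?onat_ler.
- case: (ltgtP x y) xz => // [/eqc|E].
    by rewrite cy cz => E _; move: nm; rewrite E ltnn.
  by move=> _; move: lt; rewrite E cy cz ltnNge (ltnW nm).
(* Equal leading monomials contribute equally to all coefficients, so the difference at [x] persists
   in the tails. *)
subst n; rewrite !cnf_val_cons oadd_ltr //; apply: IH => //; exists x.
move: lt; rewrite !ocoef_cons ltn_add2l; split=> // w /eqc.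
by rewrite !ocoef_cons => /addnI.
Qed.

Lemma lexlt_cons x n s t : lexlt s t -> lexlt ((x, n) :: s) ((x, n) :: t).
Proof.
move=> [z [lt eqc]]; exists z; rewrite !ocoef_cons ltn_add2l.
by split=> // y /eqc E; rewrite !ocoef_cons E.
Qed.

Lemma lexlt_head x n s t : cnf_form ((x, n) :: t) ->
  all (fun p => p.1 < x) s -> lexlt s ((x, n) :: t).
Proof.
rewrite cnf_form_cons => /and3P[n0 tx _] sx; exists x.
rewrite (ocoef_out_lt sx) ocoef_cons eqxx mul1n addn_gt0 n0; split=> // y xy.
by rewrite !ocoef_out_lt //= ?xy (all_lt_trans (ltW xy)).
Qed.

(** Together with [lexlt_val], trichotomy yields both the uniqueness of normal forms and the
    converse implication in [lexlt_ord]. *)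
Lemma lexlt_total s t : cnf_form s -> cnf_form t ->
  [\/ s = t, lexlt s t | lexlt t s].
Proof.
elim: s t => [|[y m] s IH] [|[z n] t] fs ft; first by constructor 1.
- by constructor 2; apply: lexlt_head.
- by constructor 3; apply: lexlt_head.
move: (fs) (ft); rewrite !cnf_form_cons => /and3P[m0 sy fs'] /and3P[n0 tz ft'].
case: (ltgtP y z) => [yz|zy|yz].
- constructor 2; apply: lexlt_head => //=.
  by rewrite yz (all_lt_trans (ltW yz)).
- constructor 3; apply: lexlt_head => //=.
  by rewrite zy (all_lt_trans (ltW zy)).
subst z.
have head i j u v : (i < j)%N -> all (fun p => p.1 < y) u ->
    all (fun p => p.1 < y) v -> lexlt ((y, i) :: u) ((y, j) :: v).
  move=> ij uy vy; exists y; rewrite !ocoef_cons.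
  rewrite !ocoef_out_lt // !eqxx !mul1n !addn0.
  by split=> // w yw; rewrite !ocoef_out_lt //= yw (all_lt_trans (ltW yw)).
case: (ltngtP m n) => [mn|nm|->].
- by constructor 2; apply: head.
- by constructor 3; apply: head.
have [->|H|H] := IH t fs' ft'; first by constructor 1.
- by constructor 2; apply: lexlt_cons.
- by constructor 3; apply: lexlt_cons.
Qed.

Lemma cnf_uniq s : cnf_form s -> cnf (cnf_val s) = s.
Proof.
move=> fs; set a := cnf_val s.
have [//|/(lexlt_val (cnf_formP a) fs)|/(lexlt_val fs (cnf_formP a))] :=
  lexlt_total (cnf_formP a) fs; by rewrite cnfK ltxx.
Qed.

Lemma lexlt_ord a b : lexlt (cnf a) (cnf b) <-> a < b.
Proof.
have H c d : lexlt (cnf c) (cnf d) -> c < d.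
  by move=> /(lexlt_val (cnf_formP c) (cnf_formP d)); rewrite !cnfK.
split=> [/H//|ab]; have [E||/H] // := lexlt_total (cnf_formP a) (cnf_formP b).
  by move: ab; rewrite -(cnfK a) E cnfK ltxx.
by rewrite ltNge (ltW ab).
Qed.

(** Reduces identities between natural sums to identities between natural numbers. *)
Lemma ocoef_inj a b : ocoef (cnf a) =1 ocoef (cnf b) -> a = b.
Proof.
move=> E; apply/le_anti; rewrite !leNgt; apply/andP; split;
  by apply/negP => /lexlt_ord[x []]; rewrite E ltnn.
Qed.

(** * Natural sum and product *)

Lemma ocoef_graph (f : Ord -> nat) (l : seq Ord) z : uniq l ->
  ocoef [seq (x, f x) | x <- l] z = ((z \in l) * f z)%N.
Proof.
elim: l => [_|x l IH /= /andP[xl /IH E]]; first by rewrite ocoef_nil.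
rewrite ocoef_cons E inE /= eq_sym; case: eqP => [->|_] //=.
by rewrite (negPf xl) mul0n addn0.
Qed.

Lemma ocoef_collect s : ocoef (ocollect s) =1 ocoef s.
Proof.
move=> z; rewrite ocoef_graph ?sort_uniq ?undup_uniq //.
rewrite mem_sort mem_undup.
case: (boolP (z \in _)) => [_|zs]; first exact: mul1n.
by rewrite ocoef_out.
Qed.

Lemma ocollect_form s : all (fun p => 0 < p.2)%N s -> cnf_form (ocollect s).
Proof.
move=> /allP s0; apply/andP; split.
  have -> : unzip1 (ocollect s) = sort >=%O (undup (unzip1 s)).
    by rewrite /ocollect /unzip1 -map_comp map_id.
  have geT : total (>=%O : rel Ord) by move=> x y; apply: le_total.
  have := sort_sorted geT (undup (unzip1 s)).
  (* Sorting gives a weakly decreasing list; the absence of repetitions makes it strictly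
     decreasing. *)
  have : uniq (sort >=%O (undup (unzip1 s))) by rewrite sort_uniq undup_uniq.
  elim: (sort _ _) => //= x l IH /andP[xl ul].
  rewrite (path_sortedE gt_trans) (path_sortedE (rev_trans le_trans)).
  move=> /andP[/allP lx /(IH ul) ->]; rewrite andbT; apply/allP => y yl /=.
  rewrite lt_neqAle (lx y yl : y <= x) andbT; apply/eqP => yx.
  by rewrite -yx yl in xl.
rewrite all_map; apply/allP => x.
rewrite mem_sort mem_undup => /mapP[p ps ->] /=.
(* A collected coefficient is a sum containing the positive term [p.2], so it cannot vanish. *)
rewrite lt0n; apply/eqP => E.
have := s0 p ps; suff -> : p.2 = 0%N by [].
apply/eqP; move: E; rewrite /ocoef => /eqP.
rewrite sum_nat_seq_eq0 => /allP/(_ p ps).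
by rewrite eqxx.
Qed.

Lemma cnf_pos a : all (fun p => 0 < p.2)%N (cnf a).
Proof. by have /andP[] := cnf_formP a. Qed.

Lemma cnf_nsum a b : cnf (nsum a b) = ocollect (cnf a ++ cnf b).
Proof. by apply/cnf_uniq/ocollect_form; rewrite all_cat !cnf_pos. Qed.

Lemma cnf_nprod a b : cnf (nprod a b) =
  ocollect [seq (nsum p.1 q.1, (p.2 * q.2)%N) | p <- cnf a, q <- cnf b].
Proof.
apply/cnf_uniq/ocollect_form/allP => _ /allpairsP[[p q] [ps qt ->]] /=.
by rewrite muln_gt0 (allP (cnf_pos a) p ps) (allP (cnf_pos b) q qt).
Qed.

Lemma ocoef_nsum a b x :
  ocoef (cnf (nsum a b)) x = (ocoef (cnf a) x + ocoef (cnf b) x)%N.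
Proof. by rewrite cnf_nsum ocoef_collect ocoef_cat. Qed.

Lemma nsumC a b : nsum a b = nsum b a.
Proof. by apply: ocoef_inj => x; rewrite !ocoef_nsum addnC. Qed.

Lemma cnf0 : cnf ozero = [::].
Proof. by rewrite -cnf_val_nil cnf_uniq. Qed.

Lemma nsumx0 a : nsum a ozero = a.
Proof. by apply: ocoef_inj => x; rewrite ocoef_nsum cnf0 ocoef_nil addn0. Qed.

(** Adding the coefficients of [a] to both sides keeps the highest exponent of disagreement and the
    inequality there. *)
Lemma nsum_ltr a b c : b < c -> nsum a b < nsum a c.
Proof.
move=> /lexlt_ord[x [lt eqc]]; apply/lexlt_ord; exists x.
by rewrite !ocoef_nsum ltn_add2l; split=> // y /eqc E; rewrite !ocoef_nsum E.
Qed.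

Lemma nsum_ltl a b c : b < c -> nsum b a < nsum c a.
Proof. by rewrite ![nsum _ a]nsumC; apply: nsum_ltr. Qed.

Lemma nsum_ler a b c : b <= c -> nsum a b <= nsum a c.
Proof. by rewrite le_eqVlt => /predU1P[->//|/(nsum_ltr a)/ltW]. Qed.

(** Meaningful for [a <> ozero] only, like [deg]. *)
Definition lead_coef a : nat := head 0%N (unzip2 (cnf a)).

(** * Bounds by the leading monomial, and its behaviour under natural products *)

Lemma cnf_lead a : a != ozero -> exists s, cnf a = (deg a, lead_coef a) :: s.
Proof.
move=> a0; rewrite /deg /lead_coef.
case E: (cnf a) => [|[x n] s] /=; last by exists s.
by move: a0; rewrite -(cnfK a) E cnf_val_nil eqxx.
Qed.

Lemma lead_coef_gt0 a : a != ozero -> (0 < lead_coef a)%N.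
Proof.
by move=> /cnf_lead[s E]; have := cnf_pos a; rewrite E /= => /andP[].
Qed.

Lemma lead_bounds a : a != ozero ->
  omul (oexp_omega (deg a)) (onat (lead_coef a)) <= a <
  omul (oexp_omega (deg a)) (onat (lead_coef a).+1).
Proof.
move=> /cnf_lead[s E]; have := cnf_formP a; rewrite E => /cnf_val_bounds.
by rewrite -E cnfK.
Qed.

Lemma lt_oexp_deg a : a != ozero -> a < oexp_omega (osucc (deg a)).
Proof.
move=> /lead_bounds/andP[_ /lt_le_trans]; apply.
by apply/ltW/oexp_mul_lt; rewrite olt_succ.
Qed.

Lemma oexp_deg_le a : a != ozero -> oexp_omega (deg a) <= a.
Proof.
move=> a0; have /andP[+ _] := lead_bounds a0; apply: le_trans.
by rewrite -{1}(omul1 (oexp_omega _)) omul_ler // onat_ler // lead_coef_gt0.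
Qed.

Lemma cnf_monomial x n : (0 < n)%N ->
  cnf (omul (oexp_omega x) (onat n)) = [:: (x, n)].
Proof.
move=> n0; have <- : cnf_val [:: (x, n)] = omul (oexp_omega x) (onat n).
  by rewrite cnf_val_cons cnf_val_nil oadd0.
by apply: cnf_uniq; rewrite cnf_form_cons n0.
Qed.

Lemma cnf_onat n : (0 < n)%N -> cnf (onat n) = [:: (ozero, n)].
Proof. by move=> n0; rewrite -cnf_monomial // oexp0 omul1l. Qed.

Lemma cnf_oexp x : cnf (oexp_omega x) = [:: (x, 1%N)].
Proof. by rewrite -[oexp_omega x]omul1 cnf_monomial. Qed.

Lemma deg_onat n : deg (onat n) = ozero.
Proof. by rewrite /deg; case: n => [|n]; rewrite ?cnf0 // cnf_onat. Qed.

Lemma lead_coef_onat n : lead_coef (onat n) = n.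
Proof. by rewrite /lead_coef; case: n => [|n]; rewrite ?cnf0 // cnf_onat. Qed.

Lemma deg_oexp x : deg (oexp_omega x) = x.
Proof. by rewrite /deg cnf_oexp. Qed.

(** With degree zero, [lead_bounds] would put [a] below a natural number. *)
Lemma deg_gt0 a : omega <= a -> ozero < deg a.
Proof.
move=> wa; have a0 : a != ozero.
  by rewrite -ogt0 (lt_le_trans (onat_lt_omega 0)).
rewrite ogt0; apply/eqP => d0; have /andP[_] := lead_bounds a0.
rewrite d0 oexp0 omul1l ltNge (le_trans _ wa) //.
exact/ltW/onat_lt_omega.
Qed.

Lemma nprod0x a : nprod ozero a = ozero.
Proof. by rewrite /nprod cnf0 [ocollect _]/= cnf_val_nil. Qed.

Lemma nprodx0 a : nprod a ozero = ozero.
Proof.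
rewrite /nprod cnf0.
have -> : [seq (nsum p.1 q.1, (p.2 * q.2)%N) | p <- cnf a, q <- [::]] = [::].
  by elim: (cnf a).
by rewrite [ocollect _]/= cnf_val_nil.
Qed.

Lemma nprod11 : nprod (onat 1) (onat 1) = onat 1.
Proof.
rewrite -[RHS]cnfK -[LHS]cnfK cnf_nprod cnf_onat //= nsumx0.
by rewrite /ocollect /= ocoef_cons ocoef_nil eqxx.
Qed.

(** By strict monotonicity of [nsum], only the two leading monomials contribute
    to the coefficient of the largest exponent. *)
Lemma nprod_lead a b : a != ozero -> b != ozero ->
  [/\ nprod a b != ozero, deg (nprod a b) = nsum (deg a) (deg b) &
      lead_coef (nprod a b) = (lead_coef a * lead_coef b)%N].
Proof.
move=> a0 b0; have [[s Ea] [t Eb]] := (cnf_lead a0, cnf_lead b0).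
have la := lead_coef_gt0 a0; have lb := lead_coef_gt0 b0.
set x := deg a in Ea *; set y := deg b in Eb *.
set m := lead_coef a in Ea la *; set n := lead_coef b in Eb lb *.
have := cnf_formP a; rewrite Ea cnf_form_cons => /and3P[_ /allP sx _].
have := cnf_formP b; rewrite Eb cnf_form_cons => /and3P[_ /allP ty _].
pose l := [seq (nsum p.1 q.1, (p.2 * q.2)%N) | p <- cnf a, q <- cnf b].
have El : l = (nsum x y, m * n)%N :: behead l by rewrite /l Ea Eb.
have coefE z : ocoef (cnf (nprod a b)) z = ocoef l z.
  by rewrite cnf_nprod ocoef_collect.
have lt_tail p : p \in behead l -> p.1 < nsum x y.
  have -> : behead l = [seq (nsum x q.1, (m * q.2)%N) | q <- t] ++
      [seq (nsum p.1 q.1, (p.2 * q.2)%N) | p <- s, q <- cnf b].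
    by rewrite /l Ea Eb.
  rewrite mem_cat => /orP[/mapP[q qt ->]|/allpairsP[[u v] [us vt ->]] /=].
    by rewrite nsum_ltr // ty.
  apply: (lt_le_trans (nsum_ltl _ (sx u us))); apply: nsum_ler.
  by move: vt => /=; rewrite Eb inE => /predU1P[->//|/ty/ltW].
have ctop : ocoef (cnf (nprod a b)) (nsum x y) = (m * n)%N.
  rewrite coefE El ocoef_cons eqxx mul1n (@ocoef_out_lt (behead l)) ?addn0 //.
  exact/allP.
have cabove z : nsum x y < z -> ocoef (cnf (nprod a b)) z = 0%N.
  move=> xyz; rewrite coefE ocoef_out_lt // El /= xyz.
  by apply/allP => p /lt_tail/lt_trans; apply.
have mn : (0 < m * n)%N by rewrite muln_gt0 la lb.
have p0 : nprod a b != ozero.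
  by apply/eqP => E; move: ctop mn; rewrite E cnf0 ocoef_nil => <-.
have [r Er] := cnf_lead p0; have lp := lead_coef_gt0 p0.
set d := deg _ in Er *; set k := lead_coef _ in Er lp *.
have := cnf_formP (nprod a b); rewrite Er cnf_form_cons => /and3P[_ rd _].
have ck : ocoef (cnf (nprod a b)) d = k.
  by rewrite Er ocoef_cons eqxx mul1n ocoef_out_lt ?addn0.
(* A smaller degree would kill the coefficient [m * n] at [nsum x y]; a larger one contradicts the
   vanishing of coefficients above it. *)
have dE : d = nsum x y.
  case: (ltgtP d (nsum x y)) => // [dxy|/cabove E].
    move: ctop mn; rewrite Er.
    by rewrite ocoef_out_lt /= ?dxy ?(all_lt_trans (ltW dxy)) // => <-.
  by rewrite -ck E in lp.
by split=> //; rewrite -ck dE ctop.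
Qed.

(** * Infinite sums and products *)

(** In a right fold the terms from [n] on sit innermost, in the place of the initial value.
    Comparing two partial folds thus becomes comparing initial values. *)
Lemma big_ord_split (T : Type) (idx : T) (op : T -> T -> T) (F : nat -> T) m n :
  (n <= m)%N -> \big[op/idx]_(i < m) F i =
  \big[op / \big[op/idx]_(i <- iota n (m - n)) F i]_(i < n) F i.
Proof.
move=> nm; rewrite -!(big_mkord xpredT F) /index_iota !subn0.
by rewrite -{1}(subnKC nm) iotaD big_cat_nested.
Qed.

Lemma big_ord_stable (T : Type) (idx : T) (op : T -> T -> T)
    (F : nat -> T) m n :
  (n <= m)%N -> (forall i, (n <= i)%N -> op (F i) idx = idx) ->
  \big[op/idx]_(i < m) F i = \big[op/idx]_(i < n) F i.
Proof.
move=> nm H; rewrite (big_ord_split _ _ _ nm).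
have tail k : \big[op/idx]_(i <- iota n k) F i = idx; last by rewrite tail.
elim: k n {nm} H => [|k IH] n H; first exact: big_nil.
by rewrite /= big_cons IH ?H // => i /ltnW; apply: H.
Qed.

Lemma nsum_lt_stable (b : nat -> Ord) m n : (n <= m)%N ->
  (forall i, (n <= i)%N -> b i = ozero) -> nsum_lt b m = nsum_lt b n.
Proof. by move=> nm H; apply: big_ord_stable => // i /H ->; rewrite nsumx0. Qed.

Lemma nsum_ltS_ge (b : nat -> Ord) n : nsum_lt b n <= nsum_lt b n.+1.
Proof.
rewrite /nsum_lt (big_ord_split _ _ _ (leqnSn n)).
apply: (big_rec2 (<=%O)) => [|i x y _]; [exact: ole0x|exact: nsum_ler].
Qed.

Lemma nsum_ltS_gt (b : nat -> Ord) n :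
  ozero < b n -> nsum_lt b n < nsum_lt b n.+1.
Proof.
move=> bn; rewrite /nsum_lt (big_ord_split _ _ _ (leqnSn n)).
rewrite subSnn big_cons big_nil nsumx0.
by apply: (big_rec2 (<%O)) => [//|i x y _]; exact: nsum_ltr.
Qed.

Lemma nsum_lt_mono (b : nat -> Ord) :
  {homo nsum_lt b : m n / (m <= n)%N >-> m <= n}.
Proof.
apply: (homo_leq (r := <=%O)) => [x|y x z|n]; [exact: lexx|exact: le_trans|].
exact: nsum_ltS_ge.
Qed.

Lemma nsum_inf_le (b : nat -> Ord) y :
  nsum_inf b <= y <-> forall n, nsum_lt b n <= y.
Proof.
rewrite /nsum_inf osup_le; last first.
  by exists (olsub (nsum_lt b)) => _ [n _ <-]; apply/ltW/olt_lsub; exists n.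
by split=> [H n|H _ [n _ <-]]; apply: H => //; exists n.
Qed.

Lemma nsum_lt_le_inf (b : nat -> Ord) n : nsum_lt b n <= nsum_inf b.
Proof. exact: (nsum_inf_le b _).1. Qed.

Lemma nsum_inf_eq (b : nat -> Ord) n :
  (forall i, (n <= i)%N -> b i = ozero) -> nsum_inf b = nsum_lt b n.
Proof.
move=> H; apply/le_anti; rewrite nsum_lt_le_inf andbT; apply/nsum_inf_le => m.
have [mn|/ltnW nm] := leqP m n; first exact: nsum_lt_mono.
by rewrite (nsum_lt_stable nm).
Qed.

Lemma nprod_lt_lead (alpha : nat -> Ord) n : (forall i, alpha i <> ozero) ->
  [/\ nprod_lt alpha n != ozero,
      deg (nprod_lt alpha n) = nsum_lt (fun i => deg (alpha i)) n &
      lead_coef (nprod_lt alpha n) = (\prod_(i < n) lead_coef (alpha i))%N].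
Proof.
move=> a0; rewrite /nprod_lt /nsum_lt.
(* [K] carries the product, the sum of degrees and the product of leading coefficients through the
   three folds in parallel. *)
pose K x y k := [/\ x != ozero, deg x = y & lead_coef x = k].
apply: (big_rec3 K) => [|i k y x _ [x0 <- <-]]; rewrite /K.
  by rewrite deg_onat lead_coef_onat -ogt0 one_gt0.
by apply: nprod_lead => //; apply/eqP.
Qed.

Lemma nprod_lt0 (alpha : nat -> Ord) i n :
  alpha i = ozero -> (i < n)%N -> nprod_lt alpha n = ozero.
Proof.
move=> ai lt_in; rewrite /nprod_lt (big_ord_split _ _ _ (ltnW lt_in)).
rewrite -(subnSK lt_in) /= big_cons ai nprod0x.
by elim/big_rec: _ => // j x _ ->; rewrite nprodx0.
Qed.

(** * Limits in the order topology and values of infinite products *)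

(** Convergence from below: in an interval neighbourhood of [l], the right end is respected because
    [u n <= l], the left end by the second hypothesis. *)
Lemma olim_eq (u : nat -> Ord) l N : (forall n, (N <= n)%N -> u n <= l) ->
  (forall y, y < l -> exists M, forall n, (M <= n)%N -> y < u n) ->
  lim (u @ \oo) = l.
Proof.
move=> ul lu; apply: cvg_lim; first exact: order_hausdorff.
move=> A; rewrite itv_nbhsE => -[[p q] [oi]].
rewrite itv_boundlr => /andP[pl lq] iA.
(* Only an open left end [a < l] calls on [lu]: a closed one contradicts openness, minus infinity is
   trivial, and plus infinity is impossible. *)
have [M Mp] : exists M, forall n, (M <= n)%N -> (p <= BLeft (u n))%O.
  case: p oi pl {iA} => [[] a|[]] oi pl.
  - by move: oi; case: q {lq} => [[] b|[]].
  - by have [M HM] := lu a pl; exists M => n /HM.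
  - by exists 0%N.
  - by [].
exists (maxn N M) => // n /=; rewrite geq_max => /andP[Nn Mn].
apply: iA; rewrite /= itv_boundlr Mp //=; apply: le_trans lq.
exact: ul.
Qed.

Lemma nprod_inf_const (alpha : nat -> Ord) n :
  (forall m, (n <= m)%N -> nprod_lt alpha m = nprod_lt alpha n) ->
  nprod_inf alpha = nprod_lt alpha n.
Proof.
move=> H; apply: (olim_eq (N := n)) => [m /H ->//|y yl].
by exists n => m /H ->.
Qed.

Lemma nprod_inf_eq1 (alpha : nat -> Ord) n :
  (forall i, (n <= i)%N -> alpha i = onat 1) ->
  nprod_inf alpha = nprod_lt alpha n.
Proof.
move=> H; apply: nprod_inf_const => m nm.
by apply: big_ord_stable => // i /H ->; rewrite nprod11.
Qed.

Lemma nprod_inf0 (alpha : nat -> Ord) i :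
  alpha i = ozero -> nprod_inf alpha = ozero.
Proof.
move=> ai; rewrite (@nprod_inf_const alpha i.+1) => [|m im].
  exact: nprod_lt0 ai _.
by rewrite !(nprod_lt0 ai).
Qed.

(** Positive factors never decrease the product, and each factor above 1 at least doubles it: from
    [K+1] to [2(K+1) >= K+2]. *)
Lemma prodn_unbounded (k : nat -> nat) : (forall i, (0 < k i)%N) ->
  (forall m, exists2 i, (m <= i)%N & (1 < k i)%N) ->
  forall K, exists N, forall m, (N <= m)%N -> (K < \prod_(i < m) k i)%N.
Proof.
move=> k0 k1.
have pmono : {homo (fun m => \prod_(i < m) k i)%N : m n / (m <= n)%N}.
  apply: homo_leq => [//|y x z|n]; first exact: leq_trans.
  by rewrite big_ord_recr /= leq_pmulr.
elim=> [|K [N HN]]; first by exists 0%N => m _; apply: prodn_gt0.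
have [i Ni ki] := k1 N; exists i.+1 => m /pmono; apply: leq_trans.
rewrite big_ord_recr /=; have := leq_mul (HN i Ni) ki; apply: leq_trans.
by rewrite muln2 -addnn addnS ltnS leq_addr.
Qed.

Lemma nprod_inf_finite (alpha : nat -> Ord) n :
  (forall i, alpha i <> ozero) ->
  (forall i, (n <= i)%N -> alpha i < omega) ->
  ~ (exists m, forall i, (m <= i)%N -> alpha i = onat 1) ->
  nprod_inf alpha = oexp_omega (osucc (nsum_lt (fun i => deg (alpha i)) n)).
Proof.
move=> a0 fin n1; set d := nsum_lt _ n.
have deg0 i : (n <= i)%N -> deg (alpha i) = ozero.
  by move=> /fin/olt_omega[k ->]; rewrite deg_onat.
have degE m : (n <= m)%N -> deg (nprod_lt alpha m) = d.
  by move=> nm; have [_ -> _] := nprod_lt_lead m a0; apply: nsum_lt_stable.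
have ub := prodn_unbounded (k := fun i => lead_coef (alpha i)).
apply: (olim_eq (N := n)) => [m nm|y].
  have [p0 _ _] := nprod_lt_lead m a0.
  by rewrite -(degE m nm) ltW // lt_oexp_deg.
rewrite oexpS => /lt_omul_omega[K yK].
(* A natural number is its own leading coefficient, so factors different from 1 beyond [n] supply
   infinitely many leading coefficients above 1. *)
have [i|m|N HN] := ub _ _ K; first by apply/lead_coef_gt0/eqP.
  apply: contrapT => H; apply: n1; exists (maxn m n) => i.
  rewrite geq_max => /andP[mi ni]; have /olt_omega[k ak] := fin i ni.
  have k0 : (0 < k)%N by case: k ak (a0 i) => // ->.
  have [k1|] := ltnP 1 k; first by case: H; exists i;
    rewrite // ak lead_coef_onat.
  by case: k ak k0 => [|[|k]] //.
exists (maxn n N) => m; rewrite geq_max => /andP[nm /HN KN].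
have [p0 _ lE] := nprod_lt_lead m a0.
apply: (lt_le_trans yK); have /andP[+ _] := lead_bounds p0; apply: le_trans.
by rewrite degE // omul_ler // onat_ler // lE.
Qed.

Lemma nprod_inf_infinite (alpha : nat -> Ord) :
  (forall i, alpha i <> ozero) ->
  (forall m, exists2 i, (m <= i)%N & ozero < deg (alpha i)) ->
  nprod_inf alpha = oexp_omega (nsum_inf (fun i => deg (alpha i))).
Proof.
move=> a0 inf; set S := nsum_lt (fun i => deg (alpha i)).
set beta := nsum_inf _.
(* A later positive degree raises the partial sum strictly, so [beta] is never attained. This gives
   [osucc (S m) <= beta], hence the upper bound on the partial products. *)
have Sb n : S n < beta.
  have [i ni di] := inf n; apply: le_lt_trans (nsum_lt_mono _ ni) _.
  by apply: lt_le_trans (nsum_lt_le_inf _ i.+1); apply: nsum_ltS_gt.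
have b0 : ozero < beta := olt_gt0 (Sb 0%N).
apply: (olim_eq (N := 0%N)) => [m _|y yb].
  have [p0 dE _] := nprod_lt_lead m a0.
  apply/ltW/(lt_le_trans (lt_oexp_deg p0)).
  by rewrite dE oexp_ler // osucc_le Sb.
(* For [y = ozero] the exponent [ozero] serves, as [beta] is positive. *)
have [c cb yc] : exists2 c, c < beta & y < oexp_omega (osucc c).
  by have [->|//] := lt_oexp yb; exists ozero; rewrite ?oexp_gt0.
have [n cn] : exists n, c < S n.
  apply: contrapT => /forallNP H; move: cb; apply/negP; rewrite -leNgt.
  by apply/nsum_inf_le => n; rewrite leNgt; apply/negP/H.
exists n => m nm; have [p0 dE _] := nprod_lt_lead m a0.
apply: (lt_le_trans yc); apply: le_trans (oexp_deg_le p0).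
by rewrite dE oexp_ler // osucc_le (lt_le_trans cn) // nsum_lt_mono.
Qed.

(** In each of the three regimes the value is already known: a nonzero partial product if the
    factors are eventually 1, and a power of omega otherwise. *)
Lemma nprod_inf_neq0 (alpha : nat -> Ord) :
  (forall i, alpha i <> ozero) -> nprod_inf alpha <> ozero.
Proof.
move=> a0; suff : ozero < nprod_inf alpha by rewrite ogt0 => /eqP.
have [[n fin]|inf] :=
  pselect (exists n, forall i, (n <= i)%N -> alpha i < omega).
  have [[m a1]|n1] :=
    pselect (exists m, forall i, (m <= i)%N -> alpha i = onat 1).
    by rewrite (nprod_inf_eq1 a1) ogt0; have [] := nprod_lt_lead m a0.
  by rewrite (nprod_inf_finite a0 fin n1) oexp_gt0.
rewrite nprod_inf_infinite ?oexp_gt0 // => m; apply: contrapT => H; apply: inf.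
exists m => i mi; rewrite ltNge; apply/negP => /deg_gt0 ai.
by apply: H; exists i.
Qed.


Theorem theorem2p6 (alpha : nat -> Ord) :
  let beta := nsum_inf (fun i => deg (alpha i)) in
  (nprod_inf alpha = ozero <-> exists i, alpha i = ozero) /\
  (forall n : nat,
     (forall i, (n <= i)%N -> alpha i = onat 1) ->
     nprod_inf alpha = nprod_lt alpha n) /\
  (forall n : nat,
     (forall i, alpha i <> ozero) ->
     (forall i, (n <= i)%N -> alpha i < omega) ->
     ~ (exists m : nat, forall i, (m <= i)%N -> alpha i = onat 1) ->
     nprod_inf alpha
       = oexp_omega (oadd (nsum_lt (fun i => deg (alpha i)) n) (onat 1)) /\
     oexp_omega (oadd (nsum_lt (fun i => deg (alpha i)) n) (onat 1))
       = oexp_omega (oadd beta (onat 1))) /\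
  ((forall i, alpha i <> ozero) ->
   (forall k : nat, exists2 i, (k <= i)%N & omega <= alpha i) ->
   nprod_inf alpha = nprod_inf (fun i => oexp_omega (deg (alpha i))) /\
   nprod_inf (fun i => oexp_omega (deg (alpha i))) = oexp_omega beta).
Proof.
move=> beta; split; [|split; [|split]].
- split=> [a0|[i /nprod_inf0//]]; apply: contrapT => /forallNP H.
  exact: nprod_inf_neq0 H a0.
- exact: nprod_inf_eq1.
- move=> n a0 fin n1; rewrite oaddS oadd0; split; first exact: nprod_inf_finite.
  rewrite oaddS oadd0; congr (oexp_omega (osucc _)); symmetry.
  by apply: nsum_inf_eq => i /fin/olt_omega[k ->]; rewrite deg_onat.
- move=> a0 inf; have dinf m : exists2 i, (m <= i)%N & ozero < deg (alpha i).
    by have [i mi /deg_gt0 di] := inf m; exists i.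
  suff -> : nprod_inf (fun i => oexp_omega (deg (alpha i))) = oexp_omega beta.
    by split=> //; apply: nprod_inf_infinite.
  (* Replacing each factor by its leading power preserves all degrees, so [nprod_inf_infinite] gives
     the same value for both sequences. *)
  have degK : (fun i => deg (oexp_omega (deg (alpha i)))) =
      (fun i => deg (alpha i)).
    by apply/funext => i; rewrite deg_oexp.
  rewrite nprod_inf_infinite ?degK // => [i|m].
    by apply/eqP; rewrite -ogt0 oexp_gt0.
  by have [i mi di] := dinf m; exists i; rewrite ?deg_oexp.
Qed.
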